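(* Let $p\ge 2$ be an integer. There are at least $\dfrac{e^{2\sqrt{p}}}{14}$ pairwise non-isomorphic cograph minimal obstructions for arboricity $p$.
   Context: All graphs are finite and simple. A cograph is a graph with no induced path $P_4$ on four vertices; equivalently, a graph obtainable from $K_1$ by repeatedly applying disjoint union and complement. A cograph minimal obstruction for arboricity $p$ is a cograph whose vertex set cannot be partitioned into $p$ (possibly empty) subsets each inducing a forest, but such that the vertex set of every proper induced subgraph can be so partitioned. *)

(* Defs.v *)
From mathcomp Require Import all_boot.

Set Implicit Arguments.
Unset Strict Implicit.
Unset Printing Implicit Defensive.

Record sgraph := SGraph {
  vertex :> finType;
  edge : rel vertex;
  edge_sym : symmetric edge;
  edge_irrefl : irreflexive edge
}.

Definition isomorphic (G H : sgraph) : Prop :=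
  exists2 f : G -> H, bijective f & {mono f : x y / edge x y}.

Section Induced.
Variables (G : sgraph) (S : {set G}).

Definition induced_vertex : finType := {x : G | x \in S}.
Definition induced_edge : rel induced_vertex := fun x y => edge (val x) (val y).

Lemma induced_edge_sym : symmetric induced_edge.
Proof. by move=> x y; apply: edge_sym. Qed.

Lemma induced_edge_irrefl : irreflexive induced_edge.
Proof. by move=> x; apply: edge_irrefl. Qed.

Definition induced : sgraph := SGraph induced_edge_sym induced_edge_irrefl.

End Induced.

Definition path_edge (n : nat) : rel 'I_n :=
  fun i j => (i.+1 == j :> nat) || (j.+1 == i :> nat).

Lemma path_edge_sym n : symmetric (@path_edge n).
Proof. by move=> i j; rewrite /path_edge orbC. Qed.

Lemma path_edge_irrefl n : irreflexive (@path_edge n).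
Proof. by move=> i; rewrite /path_edge orbb; apply/eqP/eqP; rewrite gtn_eqF. Qed.

(* The path on n vertices (not n edges). *)
Definition path_graph (n : nat) : sgraph :=
  SGraph (@path_edge_sym n) (@path_edge_irrefl n).

Definition cograph (G : sgraph) : Prop :=
  ~ exists S : {set G}, isomorphic (induced S) (path_graph 4).

(* A cycle of a simple graph has at least 3 vertices; ucycle also accepts the
   empty sequence and, for an edge xy, the sequence x, y. *)
Definition forest (G : sgraph) : Prop :=
  forall c : seq G, ucycle (@edge G) c -> size c <= 2.

Definition forest_partitionable (p : nat) (G : sgraph) : Prop :=
  exists V : 'I_p -> {set G},
    [/\ forall i j, i != j -> [disjoint V i & V j],
        \bigcup_(i < p) V i = [set: G]
      & forall i, forest (induced (V i))].

Definition cograph_minimal_obstruction (p : nat) (G : sgraph) : Prop :=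
  [/\ cograph G,
      ~ forest_partitionable p G
    & forall S : {set G}, S \proper [set: G] ->
        forest_partitionable p (induced S)].

(* Main.v *)
(* Complete multipartite graphs are cographs, and a set of vertices of one
   induces a forest iff at most one of its vertices lies outside some part.
   Hence, if all parts have size at most M, p forests cover at most p M + p
   vertices; with p M + p + 1 vertices and p + 1 parts of size M the graph is a
   minimal obstruction: once a vertex x is deleted, p parts of size M that avoid
   x leave at most p vertices, which are attached one to each part. So every
   partition of p + 1, with p copies of its largest part added, gives an
   obstruction, and different partitions give non-isomorphic graphs.

   It remains to bound the number P(n) of partitions of n from below by
   e^(2 sqrt (n-1)) / 14. For n > 226 this follows by induction from
   n P(n) = sum of v P(n - l v) over l, v >= 1, where the terms with l <= 3
   suffice: they contribute about 1 + 1/4 + 1/9 times the required amount, up to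
   a relative error O(1/sqrt n). For n <= 226 it is computed. *)

From Stdlib Require Import NArith.
Require Import Defs.
From mathcomp Require Import all_boot all_order all_algebra.
From mathcomp Require Import reals sequences exp.
From mathcomp Require Import zify ring lra.

Set Implicit Arguments.
Unset Strict Implicit.
Unset Printing Implicit Defensive.

Import Order.TTheory GRing.Theory Num.Theory.

(** * Complete multipartite graphs: induced paths and forests *)

Definition color_class (V C : finType) (col : V -> C) (c : C) : {set V} :=
  [set x | col x == c].

Section CompleteMultipartite.
Variables (G : sgraph) (C : finType) (col : G -> C).
Hypothesis edgeE : forall x y : G, edge x y = (col x != col y).

(** Non-adjacency is transitive in [G], whereas in the path 0-1-2-3 the non-edges 02 and 03 would
    force 23 to be a non-edge. *)
Lemma multipartite_cograph : cograph G.
Proof.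
move=> [S [f [g fK gK] f_mono]].
have colE i j : path_edge i j = (col (val (g i)) != col (val (g j))).
  by rewrite -edgeE -[RHS]/(edge (g i) (g j)) -f_mono !gK.
pose k0 : 'I_4 := @Ordinal 4 0 isT; pose k2 : 'I_4 := @Ordinal 4 2 isT.
pose k3 : 'I_4 := @Ordinal 4 3 isT.
have := colE k0 k2; have := colE k0 k3; have := colE k2 k3.
rewrite /path_edge /= => /esym/eqP E23 /esym/negbFE/eqP E03 /esym/negbFE/eqP E02.
by apply: E23; rewrite -E02 -E03.
Qed.

(** Every edge has an end outside the class [c], so all edges pass through a single vertex; a cycle
    on at least three vertices has an edge avoiding any given vertex. *)
Lemma star_forest (S : {set G}) (c : C) :
  #|[set x in S | col x != c]| <= 1 -> forest (induced S).
Proof.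
move=> /card_le1_eqP le1 s /andP[cyc uniq_s]; rewrite leqNgt; apply/negP.
have out_eq (x y : induced S) : col (val x) != c -> col (val y) != c -> x = y.
  move=> xc yc; apply/val_inj/le1; rewrite inE ?xc ?yc andbT.
    exact: (valP y).
  exact: (valP x).
have out_edge (x y : induced S) :
    edge x y -> (col (val x) != c) || (col (val y) != c).
  move=> exy; rewrite -negb_and; apply: contraL exy => /andP[/eqP xc /eqP yc].
  by rewrite /edge /= /induced_edge edgeE xc yc eqxx.
case: s cyc uniq_s => [|x0 [|x1 [|x2 s]]] //= /and3P[e01 e12 cyc].
rewrite !inE !negb_or -!andbA => /and5P[n01 n02 n0s n12 /andP[n1s _]] _.
have x1c : col (val x1) != c.
  case/orP: (out_edge _ _ e01) => // x0c.
  case/orP: (out_edge _ _ e12) => // x2c.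
  by rewrite (out_eq _ _ x0c x2c) eqxx in n02.
have only_x1 y : col (val y) != c -> y = x1 by move=> /out_eq; apply.
case: s cyc n0s n1s => [|x3 s] /=.
  rewrite andbT => /out_edge/orP[/only_x1 E|/only_x1 E] _ _.
    by rewrite E eqxx in n12.
  by rewrite E eqxx in n01.
case/andP=> /out_edge/orP[/only_x1 E|/only_x1 E] _ _; rewrite ?inE.
  by rewrite E eqxx in n12.
by rewrite E eqxx.
Qed.

(** If every class misses two vertices of [S], take [y], [z] outside the class of some [x]: they
    form a triangle with [x] or share a class. In the latter case, two vertices [u], [w] outside
    that class give a triangle [y u w] or the 4-cycle [u y w z]. *)
Lemma forest_star (c0 : C) (S : {set G}) :
  forest (induced S) -> exists c, #|[set x in S | col x != c]| <= 1.
Proof.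
move=> forS; apply/existsP; case: existsP => // no_c; exfalso.
have two c : exists x y, [/\ x \in S, y \in S, x != y, col x != c & col y != c].
  have /card_gt1P[x [y []]] : 1 < #|[set x in S | col x != c]|.
    by rewrite ltnNge; apply/negP => le1; apply: no_c; exists c.
  by rewrite !inE => /andP[xS xc] /andP[yS yc] nxy; exists x, y.
have triangle x y z : x \in S -> y \in S -> z \in S ->
    col x != col y -> col y != col z -> col z != col x -> False.
  move=> xS yS zS nxy nyz nzx.
  have neq a b : col a != col b -> a != b by apply: contraNneq => ->.
  suff /forS : ucycle (@edge (induced S))
    [:: Sub x xS : induced S; Sub y yS; Sub z zS] by [].
  rewrite /ucycle /= /edge /= /induced_edge /= !edgeE nxy nyz nzx /=.
  by rewrite !inE -!val_eqE /= negb_or !neq // eq_sym.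
have [x [_ [xS _ _ _ _]]] := two c0.
have [y [z [yS zS nyz yx zx]]] := two (col x).
have [cyz|nyz'] := eqVneq (col y) (col z); last first.
  by apply: (triangle x y z) => //; rewrite eq_sym.
have [u [w [uS wS nuw uy wy]]] := two (col y).
have [cuw|nuw'] := eqVneq (col u) (col w); last first.
  by apply: (triangle y u w) => //; rewrite eq_sym.
suff /forS : ucycle (@edge (induced S))
  [:: Sub u uS : induced S; Sub y yS; Sub w wS; Sub z zS] by [].
have neq a b : col a != col b -> a != b by apply: contraNneq => ->.
rewrite /ucycle /= /edge /= /induced_edge /= !edgeE !inE -!val_eqE /=.
rewrite -cuw -cyz uy eq_sym uy /= !negb_or nuw nyz !neq //=; rewrite -?cyz -?cuw //.
by rewrite eq_sym.
Qed.

Lemma not_forest_partitionable p M :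
  (forall c, #|color_class col c| <= M) -> p * M + p < #|G| ->
  ~ forest_partitionable p G.
Proof.
move=> leM ltG [V [_ covV forV]].
have [x _] : exists x : G, x \in [set: G].
  by apply/card_gt0P; rewrite cardsT; apply: leq_ltn_trans ltG.
have /fin_all_exists[c cV] i := forest_star (col x) (forV i).
move: ltG; rewrite ltnNge => /negP; apply.
have -> : p * M + p = \sum_(i < p) (M + 1).
  by rewrite sum_nat_const card_ord mulnDr muln1.
rewrite -cardsT -covV.
apply: (@leq_trans (\sum_(i < p) #|V i|)).
  elim/big_ind2: _ => [|A m B n leA leB|//]; first by rewrite cards0.
  by rewrite (leq_trans (leq_card_setU _ _)) ?leq_add.
apply: leq_sum => i _; rewrite -(cardsID (color_class col (c i)) (V i)).
apply: leq_add; first by rewrite (leq_trans _ (leM (c i))) ?subset_leq_card ?subsetIr.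
apply: leq_trans (cV i); apply: subset_leq_card; apply/subsetP => y.
by rewrite !inE andbC.
Qed.

Lemma forest_partitionable_colors p (d : 'I_p -> C) :
  injective d -> #|[set x | col x \notin codom d]| <= p ->
  forest_partitionable p G.
Proof.
set E := [set x | _] => d_inj leE.
have memE x : (x \in E) = (col x \notin codom d) by rewrite inE.
clearbody E.
(* The vertex of [E] at position [i] of its enumeration joins the class [d i]; all of [E] is placed
   because it has at most [p] vertices. *)
exists (fun i => [set x | (col x == d i) || (x \in E) && (index x (enum E) == i)]).
have Eout x i : x \in E -> col x == d i = false.
  rewrite memE => xE; apply: contraNF xE => /eqP->; exact: codom_f.
split=> [i j nij||i].
- apply/pred0P => x /=; apply/negP; rewrite !inE.
  have [xE|xE] := boolP (x \in E).
    rewrite !Eout //= => /andP[/eqP-> /eqP/val_inj eij].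
    by rewrite eij eqxx in nij.
  rewrite !orbF => /andP[/eqP-> /eqP/d_inj eij].
  by rewrite eij eqxx in nij.
- apply/setP => x; rewrite inE; apply/bigcupP.
  have [xE|xE] := boolP (x \in E).
    have lt_p : index x (enum E) < p.
      by apply: leq_trans leE; rewrite cardE index_mem mem_enum.
    by exists (Ordinal lt_p); rewrite // inE xE eqxx orbT.
  have := xE; rewrite memE negbK => /codomP[i xi].
  by exists i; rewrite // inE xi eqxx.
apply: (@star_forest _ (d i)); apply/card_le1_eqP => x y.
rewrite [x \in _]inE [y \in _]inE [x \in [set _ | _]]inE [y \in [set _ | _]]inE.
case/andP=> /orP[->|/andP[xE /eqP ix]] // _.
case/andP=> /orP[->|/andP[yE /eqP iy]] // _.
have : nth x (enum E) (index x (enum E)) = nth x (enum E) (index y (enum E)).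
  by rewrite ix iy.
by rewrite !nth_index ?mem_enum.
Qed.

End CompleteMultipartite.

(** * Minimal obstructions among complete multipartite graphs *)

Section Obstruction.
Variables (G : sgraph) (C : finType) (col : G -> C).
Hypothesis edgeE : forall x y : G, edge x y = (col x != col y).

Lemma multipartite_obstruction p M :
  (forall c, #|color_class col c| <= M) -> #|G| = p * M + p.+1 ->
  p < #|[set c | #|color_class col c| == M]| ->
  cograph_minimal_obstruction p G.
Proof.
move=> leM cardG ltD; split; first exact: multipartite_cograph edgeE.
  apply: not_forest_partitionable edgeE _ _ leM _.
  by rewrite cardG addnS.
move=> S /properP[_ [x _ xS]].
pose D := [set c | #|color_class col c| == M] :\ col x.
have leD : p <= #|D|.
  move: ltD; rewrite (cardsD1 (col x)) -/D; case: (_ \in _) => // ltD.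
  exact: ltnW.
pose d (i : 'I_p) := enum_val (widen_ord leD i).
have d_inj : injective d.
  by move=> i j /enum_val_inj eij; apply/val_inj/(congr1 val eij).
have dD i : d i \in D by apply: enum_valP.
apply: (@forest_partitionable_colors (induced S) C (col \o val) _ p d d_inj).
  by move=> u v; rewrite -edgeE.
rewrite -(card_imset _ val_inj).
(* [U] covers [p * M] vertices and avoids [x], so besides [x] exactly [p] vertices lie outside
   it. *)
pose U := \bigcup_(i < p) color_class col (d i).
have cardU : #|U| = p * M.
  rewrite -[p in RHS](@card_ord p) -sum_nat_const -sum1_card.
  rewrite partition_disjoint_bigcup; last first.
    move=> i j nij; apply/pred0P => y; rewrite /= !inE.
    apply: contraNF nij => /andP[/eqP-> /eqP/d_inj->]; exact: eqxx.
  apply: eq_bigr => i _; rewrite sum1_card.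
  by have := dD i; rewrite !inE => /andP[_ /eqP].
have xU : x \in ~: U.
  rewrite inE; apply/bigcupP => -[i _]; rewrite inE => /eqP xi.
  by have := dD i; rewrite !inE -xi eqxx.
have cardUC : #|~: U| = p.+1 by rewrite cardsCs setCK cardG cardU addKn.
have cardUCx : #|~: U :\ x| = p.
  by have := cardsD1 x (~: U); rewrite cardUC xU => -[].
rewrite -[leqRHS]cardUCx; apply: subset_leq_card; apply/subsetP => _ /imsetP[u uE ->].
rewrite !inE in uE *; apply/andP; split.
  by apply: contraNneq xS => <-; apply: valP.
apply: contraNN uE => /bigcupP[i _]; rewrite inE => /eqP /= ->; exact: codom_f.
Qed.

End Obstruction.

Lemma isomorphic_color_class (G H : sgraph) (C D : finType)
    (col : G -> C) (col' : H -> D) (a : nat) :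
  (forall x y : G, edge x y = (col x != col y)) ->
  (forall x y : H, edge x y = (col' x != col' y)) ->
  isomorphic G H ->
  #|[set x | #|color_class col (col x)| == a]| =
  #|[set y | #|color_class col' (col' y)| == a]|.
Proof.
move=> eG eH [f [g fK gK] f_mono].
have classE x : #|color_class col' (col' (f x))| = #|color_class col (col x)|.
  rewrite -(card_imset _ (can_inj fK)); apply: eq_card => y.
  rewrite -[y]gK (mem_imset _ _ (can_inj fK)) !inE; apply: negb_inj.
  by rewrite -eH -eG f_mono.
rewrite -(card_imset _ (can_inj fK)); apply: eq_card => y.
by rewrite -[y]gK (mem_imset _ _ (can_inj fK)) !inE classE.
Qed.

(** * Complete multipartite graphs with prescribed part sizes *)

Section PartSizes.
Variable s : seq nat.

Definition part_vertex : finType := {i : 'I_(size s) & 'I_(nth 0 s i)}.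
Definition part_edge : rel part_vertex := fun x y => tag x != tag y.

Lemma part_edge_sym : symmetric part_edge.
Proof. by move=> x y; rewrite /part_edge eq_sym. Qed.

Lemma part_edge_irrefl : irreflexive part_edge.
Proof. by move=> x; rewrite /part_edge eqxx. Qed.

Definition complete_multipartite : sgraph :=
  SGraph part_edge_sym part_edge_irrefl.

Definition part_of (x : complete_multipartite) : 'I_(size s) := tag x.

Lemma card_part_vertices (P : pred 'I_(size s)) :
  #|[set x : complete_multipartite | P (part_of x)]| =
  \sum_(i < size s | P i) nth 0 s i.
Proof.
rewrite -sum1_card.
transitivity (\sum_(i < size s | P i) \sum_(j < nth 0 s i) 1).
  by rewrite sig_big_dep /=; apply: eq_bigl => x; rewrite inE andbT.
by apply: eq_bigr => i _; rewrite sum1_card card_ord.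
Qed.

Lemma card_part (i : 'I_(size s)) : #|color_class part_of i| = nth 0 s i.
Proof. by rewrite /color_class (card_part_vertices (pred1 i)) big_pred1_eq. Qed.

Lemma card_complete_multipartite : #|complete_multipartite| = sumn s.
Proof.
rewrite -cardsT sumnE (big_nth 0) big_mkord -(card_part_vertices xpredT).
by apply: eq_card => x; rewrite !inE.
Qed.

Lemma card_parts_of_size (a : nat) :
  #|[set i | #|color_class part_of i| == a]| = count_mem a s.
Proof.
rewrite -sum1_count (big_nth 0) big_mkord sum1_card.
by apply: eq_card => i; rewrite inE card_part.
Qed.

Lemma card_vertices_in_parts (a : nat) :
  #|[set x | #|color_class part_of (part_of x)| == a]| = a * count_mem a s.
Proof.
rewrite (card_part_vertices (fun i => #|color_class part_of i| == a)).
rewrite -card_parts_of_size mulnC -sum_nat_const.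
by apply: eq_big => i; rewrite ?inE // card_part => /eqP.
Qed.

Lemma complete_multipartite_obstruction p M :
  {in s, forall a, a <= M} -> sumn s = p * M + p.+1 -> p < count_mem M s ->
  cograph_minimal_obstruction p complete_multipartite.
Proof.
move=> leM sum_s ltM; apply: (@multipartite_obstruction _ _ part_of _ _ M) => //.
- by move=> i; rewrite card_part leM // mem_nth.
- by rewrite card_complete_multipartite.
by rewrite card_parts_of_size.
Qed.

End PartSizes.

(** The parts of size [a] contain [a * count_mem a s] vertices in all, and the factor [a] cancels.
    Parts of size 0 leave no trace in the graph. *)
Lemma isomorphic_count_mem (s t : seq nat) (a : nat) :
  isomorphic (complete_multipartite s) (complete_multipartite t) ->
  0 < a -> count_mem a s = count_mem a t.
Proof.
move=> iso a_gt0.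
have := isomorphic_color_class (col := @part_of s) (col' := @part_of t) a.
move=> /(_ (fun _ _ => erefl) (fun _ _ => erefl) iso).
by rewrite !card_vertices_in_parts => /eqP; rewrite eqn_pmul2l // => /eqP.
Qed.

(** * Recurrences for the partition numbers *)

(* [m i] is the multiplicity of the part [i.+1]; the ambient bound [K] is
   irrelevant as long as [n <= K]. *)
Definition partitions (K n : nat) : {set {ffun 'I_K -> 'I_K.+1}} :=
  [set m : {ffun 'I_K -> 'I_K.+1} | \sum_(i < K) i.+1 * m i == n].

Definition npart (K n : nat) : nat := #|partitions K n|.

Lemma npart0 K : 0 < npart K 0.
Proof.
apply/card_gt0P; exists [ffun => ord0]; rewrite inE.
by rewrite big1 // => i _; rewrite ffunE muln0.
Qed.

(** Adding [l] parts of size [v.+1] is injective; [n <= K] keeps the new multiplicity in range, so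
    [inord] does not truncate. *)
Lemma npart_add_parts K n (v : 'I_K) l : n <= K -> l * v.+1 <= n ->
  npart K (n - l * v.+1) <= #|[set m in partitions K n | l <= m v]|.
Proof.
move=> leK len.
pose f (m : {ffun 'I_K -> 'I_K.+1}) :=
  [ffun i => if i == v then inord (m v + l) else m i] : {ffun 'I_K -> 'I_K.+1}.
have bound m : m \in partitions K (n - l * v.+1) -> m v + l < K.+1.
  rewrite inE (bigD1 v) //= => /eqP E; rewrite ltnS; apply: leq_trans leK.
  nia.
have f_inj : {in partitions K (n - l * v.+1) &, injective f}.
  move=> m m' /bound b /bound b' /ffunP E; apply/ffunP => i.
  have := E i; rewrite !ffunE; case: eqVneq => [->|//].
  by move=> /(congr1 val); rewrite /= !inordK // => /addIn/val_inj.
rewrite /npart -(card_in_imset f_inj); apply: subset_leq_card.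
apply/subsetP => _ /imsetP[m mP ->]; have b := bound m mP.
rewrite !inE ffunE eqxx inordK // leq_addl andbT.
move: mP; rewrite inE (bigD1 v) //= => /eqP E.
rewrite (bigD1 v) //= ffunE eqxx inordK //.
rewrite (eq_bigr (fun i : 'I_K => i.+1 * m i)); last first.
  by move=> i /negPf nv; rewrite ffunE nv.
by apply/eqP; rewrite mulnDr addnAC E [_ * l]mulnC subnK.
Qed.

Lemma count_le_nat L (P : pred nat) a :
  \sum_(1 <= l < L | P l) (l <= a : nat) <= a.
Proof.
apply: (@leq_trans (\sum_(1 <= l < L) (l <= a : nat))).
  by rewrite [leqRHS](bigID P) /= leq_addr.
case: L => [|L]; first by rewrite big_geq.
suff : \sum_(1 <= l < L.+1) (l <= a : nat) <= minn L a by lia.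
elim: L => [|L IH]; first by rewrite big_geq.
by rewrite big_nat_recr //=; case: leqP; lia.
Qed.

(* Each multiplicity is counted by the numbers [l] not exceeding it. *)
Lemma npart_rec K n L : n <= K ->
  \sum_(v < K) \sum_(1 <= l < L | l * v.+1 <= n)
     v.+1 * npart K (n - l * v.+1) <= n * npart K n.
Proof.
move=> leK.
have -> : n * npart K n = \sum_(v < K) \sum_(m in partitions K n) v.+1 * m v.
  rewrite exchange_big /= mulnC -sum_nat_const; apply: eq_bigr => m.
  by rewrite inE => /eqP.
apply: leq_sum => v _; rewrite -!big_distrr leq_mul2l /=.
apply: (@leq_trans (\sum_(1 <= l < L | l * v.+1 <= n)
    \sum_(m in partitions K n) (l <= m v : nat))).
  apply: leq_sum => l len; apply: leq_trans (npart_add_parts leK len) _.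
  rewrite -sum1_card big_mkcond [leqRHS]big_mkcond /=; apply: leq_sum => m _.
  by rewrite inE; case: (m \in _); case: (l <= _).
by rewrite exchange_big /=; apply: leq_sum => m _; apply: count_le_nat.
Qed.

Lemma big_nat_dvdn (d n : nat) (F : nat -> nat) : 0 < d ->
  \sum_(1 <= l < n.+1 | l * d <= n) F (l * d) = \sum_(1 <= j < n.+1 | d %| j) F j.
Proof.
move=> d_gt0.
have -> : \sum_(1 <= l < n.+1 | l * d <= n) F (l * d) =
          \sum_(1 <= l < (n %/ d).+1) F (l * d).
  rewrite [RHS](@big_nat_widen _ _ _ _ _ n.+1) ?ltnS ?leq_div //.
  by apply: eq_bigl => l; rewrite ltnS leq_divRL.
elim: n => [|n IH]; first by rewrite div0n !big_geq.
rewrite divnS // [RHS]big_mkcond big_nat_recr //= -big_mkcond /= -IH.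
case: ifP => [dn|_]; last by rewrite add0n addn0.
rewrite add1n big_nat_recr //=; congr (_ + F _).
by rewrite -[RHS](divnK dn) divnS // dn.
Qed.

(** The sum of the divisors of [j], a divisor being written [v.+1] as in [partitions]. *)
Definition sigma (j : nat) : nat := \sum_(0 <= v < j | v.+1 %| j) v.+1.

(** Grouping the terms of [npart_rec] by [j = l * v.+1] collects each divisor of [j] once. This is
    one half of Euler's recurrence. *)
Lemma npart_sigma K n : n <= K ->
  \sum_(1 <= j < n.+1) sigma j * npart K (n - j) <= n * npart K n.
Proof.
move=> leK; apply: leq_trans (npart_rec n.+1 leK).
have -> : \sum_(v < K) \sum_(1 <= l < n.+1 | l * v.+1 <= n)
     v.+1 * npart K (n - l * v.+1) =
   \sum_(v < K) \sum_(1 <= j < n.+1 | v.+1 %| j) v.+1 * npart K (n - j).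
  apply: eq_bigr => v _.
  by rewrite (big_nat_dvdn _ (fun j => v.+1 * npart K (n - j))).
rewrite (exchange_big_dep xpredT) //=; rewrite big_nat_cond [leqRHS]big_nat_cond.
apply: leq_sum => j /andP[/andP[_ ltj] _].
rewrite -big_distrl /= leq_mul2r; apply/orP; right.
rewrite -(big_mkord (fun v => v.+1 %| j) S) /sigma.
by rewrite [leqRHS](@big_cat_nat _ _ _ j) ?leq_addr //= (leq_trans (ltnSE ltj)).
Qed.

(** * Verified computation of the small cases *)

Fixpoint dot (w t : seq N) : N :=
  match w, t with
  | a :: w', b :: t' => (a * b + dot w' t')%num
  | _, _ => 0%num
  end.

(* The values [npart K n], ..., [npart K 0], if [w] lists [sigma 1], [sigma 2], ... *)
Fixpoint part_table (w : seq N) (n : nat) : seq N :=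
  if n is n'.+1 then
    let t := part_table w n' in (dot w t / N.of_nat n)%num :: t
  else [:: 1%num].

Definition sigmas (n : nat) : seq N :=
  [seq N.of_nat (sumn [seq d <- iota 1 j | d %| j]) | j <- iota 1 n].

Lemma nth_sigmas n i : N.to_nat (nth 0%num (sigmas n) i) <= sigma i.+1.
Proof.
(* Past the end of the list the default value 0 is a lower bound. *)
have [lt_in|le_ni] := ltnP i n; last by rewrite nth_default ?size_map ?size_iota.
rewrite (nth_map 0) ?size_iota // nth_iota // Nnat.Nat2N.id.
rewrite sumnE big_filter /sigma add1n.
by rewrite -[in leqLHS](addn0 1) iotaDl big_map /index_iota subn0.
Qed.

Lemma dot_le (w t : seq N) (W T : nat -> nat) :
  (forall i, N.to_nat (nth 0%num w i) <= W i) ->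
  (forall i, i < size t -> N.to_nat (nth 0%num t i) <= T i) ->
  N.to_nat (dot w t) <= \sum_(i < size t) W i * T i.
Proof.
elim: w t W T => [|a w IH] [|b t] W T wW tT //=.
rewrite big_ord_recl.
have := IH t (W \o S) (T \o S) (fun i => wW i.+1) (fun i => tT i.+1).
have := wW 0; have := tT 0 isT; rewrite /= => h1 h2 h3.
rewrite Nnat.N2Nat.inj_add Nnat.N2Nat.inj_mul.
by apply: leq_add; [apply: leq_mul | apply: h3].
Qed.

(** Induction with [npart_sigma]: the rounded-down quotient only lowers an entry. The table runs
    downwards from [n], so [dot] pairs [sigma 1] with the latest entry. *)
Lemma part_table_le K w n : n <= K ->
  (forall i, N.to_nat (nth 0%num w i) <= sigma i.+1) ->
  size (part_table w n) = n.+1 /\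
  forall i, i <= n -> N.to_nat (nth 0%num (part_table w n) i) <= npart K (n - i).
Proof.
move=> leK wS; elim: n leK => [|n IH] leK.
  by split=> // -[|i] // _; apply: npart0.
have [szt tP] := IH (ltnW leK).
split; first by rewrite /= szt.
case=> [_|i]; last by rewrite ltnS; apply: tP.
set q := nth _ _ 0.
have -> : q = (dot w (part_table w n) / N.of_nat n.+1)%num by [].
have := @dot_le w (part_table w n) (fun i => sigma i.+1) (fun i => npart K (n - i)) wS.
rewrite szt => /(_ tP) le_dot.
have := npart_sigma leK; rewrite big_add1 big_mkord /= => le_sig.
rewrite subn0 -(@leq_pmul2l n.+1) //.
apply: leq_trans le_sig; apply: leq_trans le_dot.
have := N.Div0.mul_div_le (dot w (part_table w n)) (N.of_nat n.+1).
lia.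
Qed.

(** Only the terms of [npart_rec] with [l * v.+1 <= p] are kept, so every argument is a successor
    and an induction hypothesis about [npart K p.+1] applies to it. *)
Lemma npart_rec_strides K p L : p < K ->
  \sum_(1 <= l < L) \sum_(k < p %/ l) k.+1 * npart K (p - l * k.+1).+1 <=
  p.+1 * npart K p.+1.
Proof.
move=> ltK; apply: leq_trans (npart_rec L ltK).
rewrite (exchange_big_dep xpredT) //= big_nat_cond [leqRHS]big_nat_cond.
apply: leq_sum => l /andP[/andP[l_gt0 _] _].
rewrite (big_ord_widen K (fun k => k.+1 * npart K (p - l * k.+1).+1)); last first.
  by rewrite (leq_trans (leq_div _ _)) // ltnW.
rewrite big_mkcond [leqRHS]big_mkcond /=; apply: leq_sum => v _.
rewrite leq_divRL // mulnC; case: ifP => // le_p.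
by rewrite (leq_trans le_p) // subSn.
Qed.

(* The least [a] with [256 sqrt p <= 11 a], up to rounding: as
   [expR (11 / 16) <= 2], it satisfies [expR (2 sqrt p) <= 2 ^ (a / 8)]. *)
Definition exp_witness (p : nat) : N := (N.sqrt (256 ^ 2 * N.of_nat p / 121) + 1)%num.

(** The inequalities [256 sqrt p <= 11 a] and [2 ^ (a / 8) <= 14 b], cleared of roots; the first
    certifies the rounding in [exp_witness]. *)
Definition exp_check (p : nat) (b : N) : bool :=
  let a := exp_witness p in
  ((256 ^ 2 * N.of_nat p <=? (11 * a) ^ 2) && (2 ^ a <=? (14 * b) ^ 8))%num.

(** Entry [i] belongs to partitions of [226 - i], that is to [p = 225 - i]. *)
Lemma exp_check_part_table :
  let t := part_table (sigmas 226) 226 in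
  all (fun i => exp_check (225 - i) (nth 0%num t i)) (iota 0 226).
Proof. by vm_compute. Qed.

Lemma to_nat_mul (a b : N) : N.to_nat (a * b) = N.to_nat a * N.to_nat b.
Proof. exact: Nnat.N2Nat.inj_mul. Qed.

Lemma to_nat_exp (a b : N) : N.to_nat (a ^ b) = N.to_nat a ^ N.to_nat b.
Proof.
rewrite -[b]Nnat.N2Nat.id Nnat.Nat2N.id; elim: (N.to_nat b) => [|n IH].
  by rewrite N.pow_0_r.
by rewrite Nnat.Nat2N.inj_succ N.pow_succ_r' to_nat_mul IH expnS.
Qed.

Lemma leq_to_nat (a b : N) : (a <=? b)%num -> N.to_nat a <= N.to_nat b.
Proof. by move=> /N.leb_le; lia. Qed.

(** This lets [part_table_le] be applied to the table of length [p.+2] when [K] is below 226. *)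
Lemma nth_part_table w n i : i <= n ->
  nth 0%num (part_table w n) i = nth 0%num (part_table w (n - i)) 0.
Proof. by elim: n i => [|n IH] [|i] //; rewrite ltnS subSS => /IH <-. Qed.

Lemma npart_exp_small K p : p <= 225 -> p < K ->
  exists a : nat, 256 ^ 2 * p <= (11 * a) ^ 2 /\ 2 ^ a <= (14 * npart K p.+1) ^ 8.
Proof.
move=> le_p ltK; exists (N.to_nat (exp_witness p)).
have lt_i : 225 - p < 226 by rewrite ltnS leq_subr.
have /allP/(_ (225 - p)) := exp_check_part_table.
rewrite mem_iota lt_i => /(_ isT); rewrite nth_part_table ?(ltnW lt_i) // subKn //.
have -> : 226 - (225 - p) = p.+1 by lia.
have [_ /(_ 0 isT)] := part_table_le ltK (nth_sigmas 226).
rewrite subn0; move: (nth _ _ 0) => b le_b /andP[/leq_to_nat le1 /leq_to_nat le2].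
move: le1 le2; rewrite !to_nat_exp !to_nat_mul !to_nat_exp Nnat.Nat2N.id => le1 le2.
split; first exact: le1.
apply: leq_trans le2 _.
by rewrite leq_exp2r //; apply: (leq_mul (leqnn 14) le_b).
Qed.

(** * From partitions to obstructions *)

Definition parts_of (K : nat) (m : {ffun 'I_K -> 'I_K.+1}) : seq nat :=
  flatten [seq nseq (m i) (i : 'I_K).+1 | i <- enum 'I_K].

Lemma sumn_parts_of K n m : m \in partitions K n -> sumn (parts_of m) = n.
Proof.
rewrite inE => /eqP <-; rewrite sumn_flatten -map_comp sumnE big_map big_enum.
by apply: eq_bigr => i _; rewrite /= sumn_nseq mulnC.
Qed.

Lemma count_parts_of K (m : {ffun 'I_K -> 'I_K.+1}) (i : 'I_K) :
  count_mem i.+1 (parts_of m) = m i.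
Proof.
rewrite count_flatten -map_comp sumnE big_map big_enum (bigD1 i) //=.
rewrite count_nseq /= eqxx mul1n big1 ?addn0 // => j nji.
by rewrite count_nseq /= eqSS -val_eqE in nji *; rewrite (negPf nji).
Qed.

Definition max_part (s : seq nat) : nat := \max_(a <- s) a.

Lemma leq_max_part (s : seq nat) a : a \in s -> a <= max_part s.
Proof. by move=> sa; apply: (@leq_bigmax_seq _ s xpredT id). Qed.

Lemma max_part_mem (s : seq nat) : 0 < sumn s -> max_part s \in s.
Proof.
rewrite /max_part; elim: s => //= a s IH sum_gt0; rewrite big_cons.
have [s0|/IH] := posnP (sumn s).
  rewrite (@big1_seq _ _ _ _ s) ?maxn0 ?mem_head // => b /andP[_ sb].
  apply/eqP; rewrite -leqn0 -s0 sumnE (big_rem b) //=; exact: leq_addr.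
by rewrite in_cons; case: leqP => _ sM; rewrite ?eqxx ?sM ?orbT.
Qed.

Definition obstruction_parts (p : nat) (s : seq nat) : seq nat :=
  nseq p (max_part s) ++ s.

Lemma obstruction_parts_obstruction p (s : seq nat) : sumn s = p.+1 ->
  cograph_minimal_obstruction p (complete_multipartite (obstruction_parts p s)).
Proof.
move=> sum_s; have sM : max_part s \in s by rewrite max_part_mem ?sum_s.
apply: (@complete_multipartite_obstruction _ p (max_part s)).
- move=> a; rewrite mem_cat => /orP[/nseqP[-> //]|]; exact: leq_max_part.
- by rewrite sumn_cat sumn_nseq sum_s mulnC.
rewrite count_cat count_nseq /= eqxx mul1n -[ltnLHS]addn0 ltn_add2l.
by rewrite -has_count has_pred1.
Qed.

(** If the largest parts differed, the larger one would occur in only one of the two lists. Once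
    they agree, the [p] added copies cancel. *)
Lemma obstruction_parts_inj p (s t : seq nat) : 0 < sumn s -> 0 < sumn t ->
  isomorphic (complete_multipartite (obstruction_parts p s))
             (complete_multipartite (obstruction_parts p t)) ->
  forall a, 0 < a -> count_mem a s = count_mem a t.
Proof.
move=> s_gt0 t_gt0 /isomorphic_count_mem iso.
have countE u a : count_mem a (obstruction_parts p u) =
    (max_part u == a) * p + count_mem a u by rewrite count_cat count_nseq.
have max_le u v : 0 < sumn v ->
    (forall a, 0 < a -> count_mem a (obstruction_parts p u) =
                        count_mem a (obstruction_parts p v)) ->
    max_part v <= max_part u.
  move=> v_gt0 E; rewrite leqNgt; apply/negP => lt_uv.
  have := E _ (leq_ltn_trans (leq0n _) lt_uv); rewrite !countE eqxx.
  rewrite (ltn_eqF lt_uv) mul0n mul1n (count_memPn _) => [/esym/eqP|].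
    rewrite addn_eq0 => /andP[_ /eqP/count_memPn].
    by rewrite max_part_mem.
  by apply/negP => /leq_max_part; rewrite leqNgt lt_uv.
have eqM : max_part s = max_part t.
  by apply/eqP; rewrite eqn_leq !max_le // => a a_gt0; rewrite iso.
by move=> a /iso; rewrite !countE eqM => /addnI.
Qed.

Local Open Scope ring_scope.

(** * Analytic estimates and the induction for large arguments *)

Section PartitionBound.
Variable R : realType.
Implicit Types (T j s b r w : R).

(** With [x = j / T ^ 2], use [sqrt (1 - x) >= 1 - x / 2 - x ^ 2 / 6] and [exp (- y) >= 1 - y] for
    [y = x ^ 2 * T / 3]. If [y >= 1] the left side is not positive; otherwise [T >= 15] makes [x]
    small enough for the first inequality. *)
Lemma expR_sqrt_sub T j : 15 <= T -> 0 <= j <= T ^+ 2 ->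
  expR (2 * T) * (expR (- (j / T)) * (1 - j ^+ 2 / (3 * T ^+ 3))) <=
  expR (2 * Num.sqrt (T ^+ 2 - j)).
Proof.
move=> T15 /andP[j0 jT].
have T0 : 0 < T by lra.
set y := j ^+ 2 / _.
have T3 : 0 < 3 * T ^+ 3 by rewrite mulr_gt0 // exprn_gt0.
have [y1|y1] := leP 1 y.
  apply: le_trans (expR_ge0 _); rewrite pmulr_rle0 ?expR_gt0 //.
  by rewrite pmulr_rle0 ?expR_gt0 //; lra.
apply: (@le_trans _ _ (expR (2 * T - j / T - y))).
  rewrite !expRD -mulrA.
  by rewrite !ler_pM2l ?expR_gt0 // expR_ge1Dx.
rewrite ler_expR.
have y0 : 0 <= y by rewrite divr_ge0 ?sqr_ge0 // ltW.
pose x := j / T ^+ 2.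
have xE : j = x * T ^+ 2 by rewrite /x divfK // sqrf_eq0 gt_eqF.
have yE : y = x ^+ 2 * T / 3 by rewrite /y xE; field; rewrite gt_eqF.
have jE : j / T = x * T by rewrite xE; field; rewrite gt_eqF.
have x0 : 0 <= x by rewrite /x divr_ge0 // sqr_ge0.
have x2 : x ^+ 2 < 1 / 5.
  by move: y1; rewrite yE => y1; nra.
have xs : x <= 9 / 20 by nra.
suff : T * (1 - x / 2 - x ^+ 2 / 6) <= Num.sqrt (T ^+ 2 - j) by rewrite jE yE; lra.
have h0 : 0 <= 1 - x / 2 - x ^+ 2 / 6 by nra.
rewrite -[leLHS]ger0_norm ?mulr_ge0 ?(ltW T0) // -sqrtr_sqr ler_wsqrtr //.
rewrite exprMn xE -subr_ge0.
have -> : T ^+ 2 - x * T ^+ 2 - T ^+ 2 * (1 - x / 2 - x ^+ 2 / 6) ^+ 2 =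
   T ^+ 2 * x ^+ 2 * (1 / 12 - x / 6 - x ^+ 2 / 36) by field.
by rewrite mulr_ge0 ?mulr_ge0 ?sqr_ge0 //; nra.
Qed.

(** The left side is the value of the infinite series: for [q = r / (1 + r)], the sum of [k * q ^ k]
    is [w] and that of [k ^ 3 * q ^ k] is [w * (1 + 6 * w)]. *)
Lemma cubic_geometric_sum r b (N : nat) (w := r * (1 + r)) (q := r / (1 + r)) :
  0 <= r -> 0 <= b -> 1 <= b * N%:R ^+ 2 ->
  w - b * w * (1 + 6 * w) <=
  \sum_(k < N) k.+1%:R * q ^+ k.+1 * (1 - b * k.+1%:R ^+ 2).
Proof.
move=> r0 b0 bN.
pose tail (x : R) := x * r + w -
  b * (x ^+ 3 * r + 3 * x ^+ 2 * w + 3 * x * (w * (1 + 2 * r)) + w * (1 + 6 * w)).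
have r1 : 1 + r != 0 by lra.
(* [q ^+ N * tail N%:R] is the sum of the terms [k >= N], all nonpositive. *)
have sumE : \sum_(k < N) k.+1%:R * q ^+ k.+1 * (1 - b * k.+1%:R ^+ 2) =
    w - b * w * (1 + 6 * w) - q ^+ N * tail N%:R.
  clear bN; elim: N => [|N IH]; first by rewrite big_ord0 /tail expr0; ring.
  rewrite big_ord_recr /= IH -[N.+1]addn1 natrD exprD expr1 /tail /w /q.
  by field.
rewrite sumE lerBrDr gerDl.
have q0 : 0 <= q ^+ N by rewrite exprn_ge0 // divr_ge0 //; lra.
rewrite mulr_ge0_le0 // /tail.
have w0 : 0 <= w by rewrite /w mulr_ge0 //; lra.
have N0 : 0 <= N%:R :> R by [].
have h1 : N%:R * r <= b * N%:R ^+ 2 * (N%:R * r).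
  by rewrite ler_peMl // mulr_ge0.
have h2 : w <= b * N%:R ^+ 2 * w by rewrite ler_peMl.
have h3 : 0 <= b * (2 * N%:R ^+ 2 * w + 3 * N%:R * (w * (1 + 2 * r)) + w * (1 + 6 * w)).
  by apply: mulr_ge0 => //; rewrite !addr_ge0 ?mulr_ge0 ?addr_ge0 ?mulr_ge0 //; lra.
lra.
Qed.

(** From [exp s >= 1 + s] and [exp (- s) >= 1 - s] one gets [1 / s - 1 <= r <= 1 / s]; insert this
    into [r * (1 + r)]. *)
Lemma expR_geometric_bounds s (r := (expR s - 1)^-1) (w := r * (1 + r)) :
  0 < s <= 1 ->
  [/\ 0 <= r, expR (- s) = r / (1 + r), (1 - s) / s ^+ 2 <= w & w <= (1 + s) / s ^+ 2].
Proof.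
move=> /andP[s0 s1].
have e1 := expR_ge1Dx s.
have e0 : 0 < expR s - 1 by lra.
have r0 : 0 < r by rewrite invr_gt0.
have eE : expR s = 1 + r^-1 by rewrite /r invrK; ring.
have rs : r <= s^-1 by rewrite /r lef_pV2 ?posrE //; lra.
have r_lb : s^-1 - 1 <= r.
  have e2 := expR_ge1Dx (- s).
  have : (1 - s) * expR s <= 1 by rewrite -ler_pdivlMr ?expR_gt0 // div1r -expRN.
  rewrite eE => h.
  have h' : (1 - s) * r^-1 <= s by lra.
  have : (1 - s) <= s * r by rewrite -ler_pdivrMr.
  move=> h2; rewrite -(ler_pM2l s0) mulrBr mulr1 divff ?gt_eqF //.
have wE : w * s ^+ 2 = (s * r) * (s + s * r) by rewrite /w; ring.
split; [exact: ltW | | | ].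
- by rewrite expRN eE; field; rewrite !gt_eqF //; lra.
- rewrite ler_pdivrMr ?exprn_gt0 //.
  have h : 1 - s <= s * r.
    by rewrite -(ler_pM2l s0) mulrBr mulr1 divff ?gt_eqF // in r_lb.
  rewrite wE -[leLHS]mulr1; apply: ler_pM; lra.
rewrite ler_pdivlMr ?exprn_gt0 //.
have h : s * r <= 1 by rewrite -ler_pdivlMl // mulr1.
by rewrite wE mulrC -[leRHS]mulr1; apply: ler_pM => //;
  rewrite ?mulr_ge0 ?addr_ge0 ?mulr_ge0 //; lra.
Qed.

(* [expR_sqrt_sub] summed over [j = l, 2l, 3l, ...] with [q = exp (- l / T)]. *)
Lemma stride_sum_ge (m l : nat) T : T = Num.sqrt m%:R -> 15 <= T -> (0 < l <= 3)%N ->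
  expR (2 * T) * ((T ^+ 2 - l%:R * T) / l%:R ^+ 2 - (T + l%:R) / (3 * T ^+ 2)
                  - 2 * (T + l%:R) ^+ 2 / (T * l%:R ^+ 2)) <=
  \sum_(k < m %/ l) k.+1%:R * expR (2 * Num.sqrt (m - l * k.+1)%:R).
Proof.
move=> TE T15 /andP[l_gt0 l_le3]; set N := (m %/ l)%N.
have T0 : 0 < T by lra.
have T2 : T ^+ 2 = m%:R by rewrite TE sqr_sqrtr.
have l1 : 1 <= l%:R :> R by rewrite ler1n.
have l3 : l%:R <= 3 :> R by rewrite ler_nat.
have l0 : l%:R != 0 :> R by rewrite gt_eqF //; lra.
have Tn0 : T != 0 by rewrite gt_eqF.
(* For [j = l * k.+1] these give [j / T = k.+1 * s] and [j ^ 2 / (3 * T ^ 3) = b * k.+1 ^ 2]. *)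
pose s := l%:R / T; pose b := l%:R ^+ 2 / (3 * T ^+ 3).
have s01 : 0 < s <= 1.
  by rewrite /s divr_gt0 ?ler_pdivrMr //=; lra.
have [r0 qE wlb wub] := expR_geometric_bounds s01.
set r := (expR s - 1)^-1 in r0 qE wlb wub; set w := r * (1 + r) in wlb wub.
have b0 : 0 <= b by rewrite divr_ge0 ?sqr_ge0 // mulr_ge0 // exprn_ge0 // ltW.
(* The remainder of [m] modulo [l] is at most 2, and [(T ^ 2 - 2) ^ 2 >= 3 * T ^ 3] for
   [T >= 15]. *)
have bN : 1 <= b * N%:R ^+ 2.
  have lN : T ^+ 2 - 2 <= l%:R * N%:R.
    rewrite T2 -natrM lerBlDr -natrD ler_nat /N [X in (X <= _)%N](divn_eq m l).
    rewrite mulnC leq_add2l -ltnS (leq_trans (ltn_pmod _ l_gt0)) //.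
  have -> : b * N%:R ^+ 2 = (l%:R * N%:R) ^+ 2 / (3 * T ^+ 3) by rewrite /b; field.
  rewrite ler_pdivlMr ?mulr_gt0 ?exprn_gt0 // mul1r.
  apply: (@le_trans _ _ ((T ^+ 2 - 2) ^+ 2)); first by nra.
  by rewrite lerXn2r // nnegrE; nra.
have := cubic_geometric_sum r0 b0 bN.
rewrite -qE -/w => geo.
apply: (@le_trans _ _ (expR (2 * T) *
    \sum_(k < N) k.+1%:R * expR (- s) ^+ k.+1 * (1 - b * k.+1%:R ^+ 2))).
  rewrite ler_pM2l ?expR_gt0 //; apply: le_trans geo.
  (* The three terms of the claim are a lower bound of [w] and upper bounds of [b * w] and
     [6 * b * w ^ 2]. *)
  have h1 : (T ^+ 2 - l%:R * T) / l%:R ^+ 2 = (1 - s) / s ^+ 2.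
    by rewrite /s; field; rewrite ?l0 ?Tn0.
  have h2 : (T + l%:R) / (3 * T ^+ 2) = b * ((1 + s) / s ^+ 2).
    by rewrite /s /b; field; rewrite ?l0 ?Tn0.
  have h3 : 2 * (T + l%:R) ^+ 2 / (T * l%:R ^+ 2) = 6 * b * ((1 + s) / s ^+ 2) ^+ 2.
    by rewrite /s /b; field; rewrite ?l0 ?Tn0.
  rewrite h1 h2 h3.
  have w0 : 0 <= w by rewrite mulr_ge0 // addr_ge0.
  have g1 : b * w <= b * ((1 + s) / s ^+ 2) by rewrite ler_wpM2l.
  have g2 : b * w ^+ 2 <= b * ((1 + s) / s ^+ 2) ^+ 2.
    by rewrite ler_wpM2l // lerXn2r // nnegrE // (le_trans w0).
  lra.
rewrite big_distrr /=; apply: ler_sum => k _.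
have le_m : (l * k.+1 <= m)%N.
  by rewrite mulnC -leq_divRL // ltn_ord.
have jT : 0 <= ((l * k.+1)%:R : R) <= T ^+ 2 by rewrite ler0n T2 ler_nat.
have := expR_sqrt_sub T15 jT; rewrite T2 -natrB // => le_k.
have -> : expR (2 * T) * (k.+1%:R * expR (- s) ^+ k.+1 * (1 - b * k.+1%:R ^+ 2)) =
  k.+1%:R * (expR (2 * T) * (expR (- s) ^+ k.+1 * (1 - b * k.+1%:R ^+ 2))) by ring.
rewrite ler_wpM2l //; apply: le_trans le_k.
rewrite -expRM_natl.
have -> : k.+1%:R * - s = - ((l * k.+1)%:R / T) :> R.
  by rewrite natrM /s; field.
have -> : b * k.+1%:R ^+ 2 = (l * k.+1)%:R ^+ 2 / (3 * T ^+ 3).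
  by rewrite natrM /b; field.
by [].
Qed.

(** The leading coefficient [1 + 1/4 + 1/9 = 49/36] leaves a surplus of [13/36 * T ^ 2], which for
    [T >= 15] outweighs all lower-order losses; the Horner form below shows this factor by
    factor. *)
Lemma three_strides T (h := fun l : nat => (T ^+ 2 - l%:R * T) / l%:R ^+ 2 -
    (T + l%:R) / (3 * T ^+ 2) - 2 * (T + l%:R) ^+ 2 / (T * l%:R ^+ 2)) :
  15 <= T -> T ^+ 2 + 1 <= \sum_(1 <= l < 4) h l.
Proof.
move=> T15.
have T0 : 0 < T by lra.
rewrite 3?big_ltn // big_geq // addr0 /h -subr_ge0.
set lhs := (X in 0 <= X).
have -> : lhs = (36 * T ^+ 2)^-1 * (36 * T ^+ 2 * lhs).
  by rewrite mulKf // gt_eqF // mulr_gt0 // exprn_gt0.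
apply: mulr_ge0; first by rewrite invr_ge0 mulr_ge0 // sqr_ge0.
have -> : 36 * T ^+ 2 * lhs = T * (T * (T * (13 * T - 164) - 300) - 252) - 72.
  by rewrite /lhs; field; rewrite gt_eqF.
have a1 : 31 <= 13 * T - 164 by lra.
have a2 : 165 <= T * (13 * T - 164) - 300 by nra.
have a3 : 12 <= T * (T * (13 * T - 164) - 300) - 252 by nra.
by nra.
Qed.

(** [exp (1 / 64) <= 1 / (1 - 1 / 64) = 64 / 63], and [11 / 16 = 44 / 64]; it remains to compare
    [64 ^ 44] with [2 * 63 ^ 44] in binary arithmetic. *)
Lemma expR_11_16 : expR (11 / 16) <= 2 :> R.
Proof.
have e : expR (1 / 64) <= 64 / 63 :> R.
  have := expR_ge1Dx (- (1 / 64) : R); rewrite expRN => h.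
  rewrite -[leLHS]invrK -[leRHS]invrK lef_pV2 ?posrE ?invr_gt0 ?expR_gt0 //; lra.
have -> : 11 / 16 = (1 / 64) *+ 44 :> R by rewrite -mulr_natr; field.
rewrite -mulr_natl expRM_natl.
apply: (@le_trans _ _ ((64 / 63) ^+ 44)).
  by rewrite lerXn2r ?nnegrE ?expR_ge0 ?divr_ge0.
rewrite expr_div_n ler_pdivrMr ?exprn_gt0 //.
have pow_le (a b c n : nat) : (a ^ n <= c * b ^ n)%N ->
    a%:R ^+ n <= c%:R * b%:R ^+ n :> R.
  by rewrite -(ler_nat R) natrM !natrX.
apply: (pow_le 64 63 2 44)%N.
have : (N.to_nat (64 ^ 44) <= N.to_nat (2 * 63 ^ 44))%N.
  by apply: leq_to_nat; vm_compute.
rewrite to_nat_mul !to_nat_exp.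
have -> : N.to_nat 64 = 64%N by []; have -> : N.to_nat 63 = 63%N by [].
by have -> : N.to_nat 44 = 44%N by []; have -> : N.to_nat 2 = 2%N by [].
Qed.

(** In eighth powers: [exp (16 sqrt p) <= exp (11 / 16) ^ a <= 2 ^ a <= (14 * X) ^ 8]. *)
Lemma expR_sqrt_le (p a X : nat) :
  (256 ^ 2 * p <= (11 * a) ^ 2)%N -> (2 ^ a <= (14 * X) ^ 8)%N ->
  expR (2 * Num.sqrt (p%:R : R)) / 14 <= X%:R.
Proof.
rewrite -!(ler_nat R) !natrX !natrM => le_p le_a.
rewrite ler_pdivrMr // [leRHS]mulrC -(@ler_pXn2r _ 8) ?nnegrE ?expR_ge0 ?mulr_ge0 //.
apply: le_trans le_a; apply: (@le_trans _ _ (expR (11 / 16) ^+ a)); last first.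
  by rewrite lerXn2r ?nnegrE ?expR_ge0 // expR_11_16.
rewrite -!expRM_natl ler_expR.
suff : 256 * Num.sqrt p%:R <= 11 * a%:R :> R by lra.
rewrite -(@ler_pXn2r _ 2) ?nnegrE ?mulr_ge0 ?sqrtr_ge0 //.
by rewrite exprMn sqr_sqrtr // [256 ^+ 2]expr2.
Qed.

Lemma npart_lower_bound K p : (p < K)%N ->
  expR (2 * Num.sqrt (p%:R : R)) / 14 <= (npart K p.+1)%:R.
Proof.
elim/ltn_ind: p => p IH ltK.
(* Since [225 = 15 ^ 2], every [p] beyond the table satisfies the condition [T >= 15] of the
   estimates. *)
have [le_p|lt_p] := leqP p 225.
  by have [a [le1 le2]] := npart_exp_small le_p ltK; apply: expR_sqrt_le le1 le2.
set T := Num.sqrt p%:R.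
have T15 : 15 <= T.
  rewrite -[15]ger0_norm // -sqrtr_sqr ler_wsqrtr // -natrX ler_nat.
  exact: ltnW.
have T2 : T ^+ 2 = p%:R by rewrite sqr_sqrtr.
rewrite -(@ler_pM2l _ p.+1%:R) // -natrM.
have := npart_rec_strides 4 ltK; rewrite -(ler_nat R); apply: le_trans.
rewrite natr_sum.
apply: (@le_trans _ _ (\sum_(1 <= l < 4) \sum_(k < p %/ l)
    k.+1%:R * (expR (2 * Num.sqrt (p - l * k.+1)%:R) / 14))); last first.
  apply: ler_sum_nat => l /andP[l_gt0 _]; rewrite natr_sum; apply: ler_sum => k _.
  rewrite natrM ler_wpM2l //; apply: IH.
    have : (k.+1 * l <= p)%N by rewrite -leq_divRL.
    nia.
  exact: leq_ltn_trans (leq_subr _ _) ltK.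
have -> : p.+1%:R = T ^+ 2 + 1 by rewrite T2 natr1.
have exp0 : 0 < expR (2 * T) / 14 by rewrite divr_gt0 ?expR_gt0.
apply: (le_trans (ler_wpM2r (ltW exp0) (three_strides T15))).
rewrite big_distrl /=; apply: ler_sum_nat => l l_bounds.
have := stride_sum_ge (erefl T) T15 l_bounds.
move=> le_l.
rewrite mulrA ler_pdivrMr // [leLHS]mulrC; apply: le_trans le_l _.
rewrite big_distrl /=; apply: ler_sum => k _.
by rewrite -[leRHS]mulrA divfK ?pnatr_eq0.
Qed.

End PartitionBound.

Theorem proposition6 (R : realType) (p : nat) (hp : (2 <= p)%N) :
  exists (N : nat) (G : 'I_N -> sgraph),
    [/\ expR (2%:R * Num.sqrt (p%:R : R)) / 14%:R <= N%:R,
        forall i, cograph_minimal_obstruction p (G i)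
      & forall i j, i != j -> ~ isomorphic (G i) (G j)].
Proof.
pose parts (i : 'I_(npart p.+1 p.+1)) := parts_of (enum_val i).
have sum_parts i : sumn (parts i) = p.+1 by apply: sumn_parts_of (enum_valP i).
exists (npart p.+1 p.+1),
  (fun i => complete_multipartite (obstruction_parts p (parts i))).
split=> [|i|i j /eqP nij].
- exact: npart_lower_bound.
- exact: obstruction_parts_obstruction.
move=> /obstruction_parts_inj; rewrite !sum_parts => /(_ isT isT) E; apply: nij.
(* A multiplicity function is determined by the counts of the positive sizes [k.+1]. *)
apply/enum_val_inj/ffunP => k; apply/val_inj.
by rewrite /= -!count_parts_of E.
Qed.
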